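(* Let $k\ge 4$ and let $H$ be a $k$-uniform linear hyperpath with $m$ hyperedges. Then $\lambda(H)=m(k-3)+2$.
   Context: A hypergraph $H$ is a pair $(V(H),E(H))$ with $V(H)$ a finite set and $E(H)$ a finite family of non-empty subsets of $V(H)$ (hyperedges) whose union is $V(H)$. Standing assumption: all hypergraphs are connected and Sperner (no hyperedge is a subset of another hyperedge). $H$ is $k$-uniform if every hyperedge has exactly $k$ elements, and linear if $|E_i\cap E_j|\le 1$ for distinct hyperedges $E_i,E_j$. $H$ is a hyperpath if its hyperedges can be ordered as a sequence $E_1,\ldots,E_m$ such that, for $i\neq j$, $E_i\cap E_j\ne\emptyset$ if and only if $|i-j|=1$. For a vertex $u$, $N(u)$ is the set of vertices $v\ne u$ such that some hyperedge contains both $u$ and $v$. A set $S\subseteq V(H)$ is locating-dominating if for any two distinct $u,v\in V(H)-S$, $N(u)\cap S\neq N(v)\cap S$, and $N(u)\cap S\ne\emptyset$ for every $u\in V(H)-S$. $\lambda(H)$ is the minimum cardinality of a locating-dominating set of $H$. *)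

(* Defs.v *)
From mathcomp Require Import all_boot all_order all_algebra.

Set Implicit Arguments.
Unset Strict Implicit.
Unset Printing Implicit Defensive.

(* The vertex set V(H) is the whole finite type V.  Hyperedges form a set     *)
(* rather than a multiset: repeated hyperedges are excluded anyway for        *)
(* Sperner hypergraphs, to which everything is restricted.                    *)
Record hypergraph (V : finType) := Hypergraph {
  hyperedges : {set {set V}};
  hyperedges_neq0 : set0 \notin hyperedges;
  hyperedges_cover : cover hyperedges = [set: V]
}.

Section Hypergraph.
Variables (V : finType) (H : hypergraph V).
Implicit Types (u v : V) (S E F : {set V}).

Definition neighbors u : {set V} :=
  [set v | (v != u) && [exists E in hyperedges H, (u \in E) && (v \in E)]].

Definition hconnected : Prop :=
  forall u v, connect (fun x y => y \in neighbors x) u v.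

Definition sperner : Prop :=
  forall E F, E \in hyperedges H -> F \in hyperedges H -> E != F ->
  ~~ (E \subset F).

Definition uniform (k : nat) : Prop :=
  forall E, E \in hyperedges H -> #|E| = k.

Definition linear_hypergraph : Prop :=
  forall E F, E \in hyperedges H -> F \in hyperedges H -> E != F ->
  #|E :&: F| <= 1.

(* [s] may be empty, so the empty hypergraph is a hyperpath here.  The        *)
(* distance `|i - j|%N is absz of an integer difference, not truncated.       *)
Definition hyperpath : Prop :=
  exists s : seq {set V},
    [/\ uniq s, s =i hyperedges H
      & forall i j : nat, i < size s -> j < size s -> i != j ->
        (nth set0 s i :&: nth set0 s j != set0) <-> `|i - j|%N = 1].

Definition locating_dominating S : bool :=
  [forall u, forall v,
     [&& u \notin S, v \notin S & u != v] ==>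
       (neighbors u :&: S != neighbors v :&: S)]
  && [forall u, (u \notin S) ==> (neighbors u :&: S != set0)].

(* The full vertex set is only the default value that [arg min] requires. *)
Definition location_domination_number : nat :=
  #|[arg min_(S < [set: V] | locating_dominating S) #|S| ]|.

Lemma locating_dominatingT : locating_dominating [set: V].
Proof.
apply/andP; split; last by apply/forallP => u; rewrite inE.
by apply/forallP => u; apply/forallP => v; rewrite inE.
Qed.

Lemma location_domination_numberP :
  (exists2 S, locating_dominating S & #|S| = location_domination_number) /\
  (forall S, locating_dominating S -> location_domination_number <= #|S|).
Proof.
rewrite /location_domination_number.
by case: arg_minnP => [|S ldS minS]; [exact: locating_dominatingT | split=> //; exists S].
Qed.

End Hypergraph.

(* Main.v *)
Require Import Defs.
From mathcomp Require Import all_boot all_order all_algebra.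
From mathcomp Require Import zify.

(** Call a vertex private to [E] when [E] is the only hyperedge through it.
    In a linear hypergraph each of whose hyperedges has at least two private
    vertices, the location-domination number is the sum over the hyperedges
    [E] of [#|private E|.-1] ([location_domination_number_linear]).

    Lower bound: two private vertices of the same hyperedge have the same
    closed neighborhood, so a locating set contains all of them but at most
    one; the sets of private vertices being disjoint, these contributions add
    up ([private_sum_le_card]).

    Upper bound: keep all private vertices but one in each hyperedge
    ([trimmed_locating_dominating]).  The trace of the neighborhood of a
    missed vertex [u] on this set meets [private E] exactly when [u] is in
    [E], so missed vertices with equal traces lie in the same hyperedges, and
    by linearity they coincide.

    In a [k]-uniform linear hyperpath, the vertices of a hyperedge that are
    not private are its joints with its neighbors in the path: one for each
    neighbor, and distinct because the two neighbors are disjoint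
    ([card_private_nth]).  Thus each of the [m] hyperedges contributes
    [k - 3], plus 1 for being first and 1 for being last, and these
    corrections add up to 2 even when [m = 1].  The bound [4 <= k] guarantees
    two private vertices in an inner hyperedge. *)

Set Implicit Arguments.
Unset Strict Implicit.
Unset Printing Implicit Defensive.

(** * Private vertices *)

Section PrivateVertices.
Variables (V : finType) (H : hypergraph V).
Implicit Types (u v w : V) (S E F : {set V}).

Lemma mem_hyperedge v : exists2 E, E \in hyperedges H & v \in E.
Proof.
have : v \in cover (hyperedges H) by rewrite hyperedges_cover inE.
by case/bigcupP=> E; exists E.
Qed.

Lemma neighborsP u v :
  reflect (v != u /\ exists2 E, E \in hyperedges H & (u \in E) && (v \in E))
          (v \in neighbors H u).
Proof.
rewrite inE; apply: (iffP andP) => -[vu].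
  by case/exists_inP=> E HE uvE; split=> //; exists E.
by case=> E HE uvE; split=> //; apply/exists_inP; exists E.
Qed.

Definition private E : {set V} :=
  [set v in E | [forall F in hyperedges H, (v \in F) ==> (F == E)]].

Lemma privateP E v :
  reflect (v \in E /\ forall F, F \in hyperedges H -> v \in F -> F = E)
          (v \in private E).
Proof.
rewrite inE; apply: (iffP andP) => -[vE].
  by move/forall_inP=> uniqE; split=> // F /uniqE/implyP FE vF; apply/eqP/FE.
move=> uniqE; split=> //; apply/forall_inP=> F HF.
by apply/implyP=> vF; apply/eqP/uniqE.
Qed.

Lemma private_sub E : private E \subset E.
Proof. by apply/subsetP=> v /privateP[]. Qed.

Lemma private_hyperedge E v : v \in private E -> E \in hyperedges H.
Proof.
by case/privateP=> _ uniqE; have [F HF vF] := mem_hyperedge v; rewrite -(uniqE F).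
Qed.

Lemma private_inj E F v : v \in private E -> v \in private F -> E = F.
Proof.
move=> vE /privateP[_ uniqF]; apply: uniqF (private_hyperedge vE) _.
by case/privateP: vE.
Qed.

(** The union ranges over all sets [E] and the sum over the hyperedges only:
    a set that is not a hyperedge has no private vertex. *)
Lemma card_bigcup_private (A : {set V} -> {set V}) :
    (forall E, A E \subset private E) ->
  #|\bigcup_E A E| = \sum_(E in hyperedges H) #|A E|.
Proof.
move=> subA; rewrite -sum1_card partition_disjoint_bigcup => [|E F].
  rewrite [RHS]big_mkcond; apply: eq_bigr => E _; rewrite sum1_card.
  case: ifPn => // notHE; apply/eqP; rewrite cards_eq0 -subset0.
  apply/subsetP=> v /(subsetP (subA E))/private_hyperedge.
  by rewrite (negPf notHE).
apply: contraNT => /pred0Pn[v /andP[vE vF]].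
by apply/eqP/(@private_inj _ _ v); apply: (subsetP (subA _)).
Qed.

(** Private vertices of the same hyperedge are twins: each is adjacent to
    exactly the other vertices of that hyperedge.  So their traces on a set
    avoiding both coincide, and a locating set can miss at most one of them. *)
Lemma card_private_setD_le1 S E :
  locating_dominating H S -> #|private E :\: S| <= 1.
Proof.
case/andP=> /forallP locS _.
have nbr x y w : x \in private E -> y \in private E -> y \notin S ->
    w \in neighbors H x -> w \in S -> w \in neighbors H y.
  move=> xE yE yS /neighborsP[_ [F HF /andP[xF wF]]] wS.
  apply/neighborsP; split; first by apply: contraNneq yS => <-.
  exists F => //; rewrite wF andbT; case/privateP: xE => _ /(_ F HF xF) ->.
  by case/privateP: yE.
apply/card_le1_eqP=> u v; rewrite !inE => /andP[uS uE] /andP[vS vE].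
have [//|neq_uv] := eqVneq u v.
have /forallP/(_ v) := locS u; rewrite uS vS neq_uv /= => /eqP[].
apply/setP=> w; apply/setIP/setIP=> -[wN wS]; split=> //.
  by apply: nbr wN wS; rewrite // inE.
by apply: nbr wN wS; rewrite // inE.
Qed.

Lemma private_sum_le_card S : locating_dominating H S ->
  \sum_(E in hyperedges H) #|private E|.-1 <= #|S|.
Proof.
move=> ldS; apply: (@leq_trans #|\bigcup_E (private E :&: S)|).
  rewrite card_bigcup_private => [|E]; last exact: subsetIl.
  apply: leq_sum => E _; rewrite -(cardsID S (private E)).
  by have := card_private_setD_le1 E ldS; lia.
by apply/subset_leq_card/bigcupsP=> E _; apply: subsetIr.
Qed.

(** Dropping the vertex that [pick] returns, if any, makes sense for every set
    [E], so that unions can range over all [E] without selecting a vertex in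
    each hyperedge beforehand. *)
Definition trimmed E : {set V} :=
  [set v in private E | [pick w in private E] != Some v].

Lemma trimmed_sub E : trimmed E \subset private E.
Proof. by apply/subsetP=> v /setIdP[]. Qed.

Lemma card_trimmed E : #|trimmed E| = #|private E|.-1.
Proof.
rewrite /trimmed; case: pickP => [w wE | noE].
  rewrite (cardsD1 w (private E)) wE /=; apply: eq_card => v.
  by rewrite !inE andbC eq_sym.
rewrite (eq_card0 noE); apply/eqP; rewrite cards_eq0.
by apply/eqP/setP=> v; rewrite !inE; have := noE v; rewrite !inE => ->.
Qed.

(** Trimming each hyperedge leaves a locating-dominating set: the trace of a
    missed vertex [u] meets every hyperedge through [u] in a vertex private to
    it, so it determines which hyperedges contain [u].  If there are at least
    two of them, linearity determines [u]; if there is only one, [u] is the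
    single vertex trimmed from it. *)
Lemma trimmed_locating_dominating :
    linear_hypergraph H ->
    (forall E, E \in hyperedges H -> 1 < #|private E|) ->
  locating_dominating H (\bigcup_E trimmed E).
Proof.
move=> linH gt1; set S := \bigcup_E _.
have trace E u : E \in hyperedges H -> u \in E -> u \notin S ->
    exists2 w, w \in trimmed E & w \in neighbors H u :&: S.
  move=> HE uE uS; have /card_gt0P[w wE] : 0 < #|trimmed E|.
    by rewrite card_trimmed; have := gt1 E HE; lia.
  have wS : w \in S by apply/bigcupP; exists E.
  exists w => //; rewrite inE wS andbT; apply/neighborsP; split.
    by apply: contraNneq uS => <-.
  by exists E; rewrite // uE (subsetP (private_sub E)) ?(subsetP (trimmed_sub E)).
apply/andP; split; last first.
  apply/forallP=> u; apply/implyP=> uS; apply/set0Pn.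
  have [E HE uE] := mem_hyperedge u.
  by have [w _ wN] := trace E u HE uE uS; exists w.
have transfer u v E : u \notin S -> neighbors H u :&: S = neighbors H v :&: S ->
    E \in hyperedges H -> u \in E -> v \in E.
  move=> uS eqN HE uE; have [w wE] := trace E u HE uE uS; rewrite eqN.
  case/setIP=> /neighborsP[_ [F HF /andP[vF wF]]] _.
  have /privateP[_ /(_ F HF wF) <- //] := subsetP (trimmed_sub E) w wE.
have missed E x : x \in private E -> x \notin S -> [pick w in private E] = Some x.
  move=> xE; apply: contraNeq => neq; apply/bigcupP; exists E => //.
  by rewrite inE xE.
apply/forallP=> u; apply/forallP=> v; apply/implyP=> /and3P[uS vS].
apply: contraNneq => eqN.
have uv E HE : u \in E -> v \in E := transfer u v E uS eqN HE.
have vu E HE : v \in E -> u \in E := transfer v u E vS (esym eqN) HE.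
have [E HE uE] := mem_hyperedge u.
have [uP|] := boolP (u \in private E).
  have vP : v \in private E.
    apply/privateP; split=> [|F HF /(vu F HF)]; first exact: uv.
    by case/privateP: uP => _; apply.
  by apply/eqP; have := missed E u uP uS; rewrite (missed E v vP vS) => -[].
rewrite inE uE /= => /forall_inPn[F HF]; rewrite negb_imply => /andP[uF neqFE].
apply/eqP; have /card_le1_eqP := linH F E HF HE neqFE; apply.
  by rewrite inE !uv.
by rewrite inE uF uE.
Qed.

Theorem location_domination_number_linear :
    linear_hypergraph H ->
    (forall E, E \in hyperedges H -> 1 < #|private E|) ->
  location_domination_number H = \sum_(E in hyperedges H) #|private E|.-1.
Proof.
move=> linH gt1; have [[S ldS cardS] minH] := location_domination_numberP H.
apply/eqP; rewrite eqn_leq -{2}cardS private_sum_le_card // andbT.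
apply: leq_trans (minH _ (trimmed_locating_dominating linH gt1)) _.
rewrite card_bigcup_private; last exact: trimmed_sub.
by apply/eq_leq/eq_bigr=> E _; rewrite card_trimmed.
Qed.

End PrivateVertices.

(** * Hyperpaths *)

Section Hyperpath.
Variables (V : finType) (H : hypergraph V) (k : nat) (s : seq {set V}).
Hypotheses (unifH : uniform H k) (linH : linear_hypergraph H).
Hypotheses (uniq_s : uniq s) (memE : s =i hyperedges H).
Hypothesis meetP : forall i j : nat, i < size s -> j < size s -> i != j ->
  (nth set0 s i :&: nth set0 s j != set0) <-> `|i - j|%N = 1.

Local Notation E_ i := (nth set0 s i).

Lemma nth_hyperedge i : i < size s -> E_ i \in hyperedges H.
Proof. by move=> lt_i; rewrite -memE mem_nth. Qed.

Lemma card_joint i : i.+1 < size s -> #|E_ i :&: E_ i.+1| = 1.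
Proof.
move=> lt_i; have neq : i != i.+1 by lia.
apply/eqP; rewrite eqn_leq linH ?nth_hyperedge ?nth_uniq //=; try lia.
by rewrite card_gt0; apply/meetP; lia.
Qed.

(** The case [i = 0] is separate because [i.-1] is then [i] itself. *)
Definition joint_before i : {set V} :=
  if 0 < i then E_ i.-1 :&: E_ i else set0.

(** For the last hyperedge this is [set0], the default value of [nth]. *)
Definition joint_after i : {set V} := E_ i :&: E_ i.+1.

Lemma card_joint_before i : i < size s -> #|joint_before i| = (0 < i).
Proof.
rewrite /joint_before; case: i => [|i] lt_i /=; first by rewrite cards0.
exact: card_joint.
Qed.

Lemma card_joint_after i : i < size s -> #|joint_after i| = (i.+1 < size s).
Proof.
move=> lt_i; rewrite /joint_after; have [|ge_i] := ltnP; first exact: card_joint.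
by rewrite (nth_default _ ge_i) setI0 cards0.
Qed.

(** The predecessor and the successor of a hyperedge are at distance 2 in the
    path, so they are disjoint. *)
Lemma joints_disjoint i : i < size s ->
  joint_before i :&: joint_after i = set0.
Proof.
move=> lt_i; rewrite /joint_before /joint_after.
case: i lt_i => [|i] lt_i /=; first by rewrite set0I.
have [lt_i2|ge_i2] := ltnP i.+2 (size s); last first.
  by rewrite (nth_default _ ge_i2) !setI0.
have neq : i != i.+2 by lia.
apply/setP=> v; rewrite !inE; apply/negP=> /andP[/andP[vi _] /andP[_ vi2]].
have /(meetP (ltnW (ltnW lt_i2)) lt_i2 neq) : E_ i :&: E_ i.+2 != set0.
  by apply/set0Pn; exists v; rewrite inE vi.
by lia.
Qed.

(** A second hyperedge through a vertex of [E_ i] meets [E_ i], hence is one of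
    its two neighbors in the path. *)
Lemma private_nth i : i < size s ->
  private H (E_ i) = E_ i :\: (joint_before i :|: joint_after i).
Proof.
move=> lt_i; apply/setP=> v; apply/privateP/setDP=> -[vE].
  move=> uniqE; split=> //; rewrite inE negb_or; apply/andP; split.
    rewrite /joint_before; case: ifP => i_gt0; last by rewrite inE.
    rewrite inE vE andbT; apply/negP=> vE'.
    have lt_i' : i.-1 < size s by lia.
    have /eqP := uniqE _ (nth_hyperedge lt_i') vE'.
    by rewrite nth_uniq //; lia.
  rewrite inE vE /=; apply/negP=> vE'.
  have [lt_i'|ge_i'] := ltnP i.+1 (size s).
    have /eqP := uniqE _ (nth_hyperedge lt_i') vE'.
    by rewrite nth_uniq //; lia.
  by move: vE'; rewrite (nth_default _ ge_i') inE.
rewrite inE negb_or /joint_before /joint_after inE vE /= => /andP[nb na].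
split=> // F; rewrite -memE => /(nthP set0)[j lt_j <-] vF.
have [->//|neq_ji] := eqVneq j i.
have dist1 : `|j - i|%N = 1.
  by apply/meetP=> //; apply/set0Pn; exists v; rewrite inE vF.
have [ji|ji] : j = i.+1 \/ (0 < i /\ j = i.-1) by lia.
  by case/negP: na; rewrite -ji.
by case: ji => i_gt0 ji; case/negP: nb; rewrite i_gt0 -ji inE vF vE.
Qed.

Lemma card_private_nth i : i < size s ->
  #|private H (E_ i)| = k - ((0 < i) + (i.+1 < size s)).
Proof.
move=> lt_i; rewrite private_nth // cardsDS; last first.
  rewrite subUset /joint_after subsetIl andbT /joint_before.
  by case: ifP => _; rewrite ?sub0set ?subsetIr.
rewrite (unifH (nth_hyperedge lt_i)) cardsU joints_disjoint // cards0 subn0.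
by rewrite card_joint_before // card_joint_after.
Qed.

Lemma sum_private_hyperpath : 3 <= k -> 0 < size s ->
  \sum_(E in hyperedges H) #|private H E|.-1 = size s * (k - 3) + 2.
Proof.
move=> k_ge3; case size_s: (size s) => [//|n] _.
rewrite (eq_bigl (mem s)) => [|E]; last by rewrite /= memE.
rewrite -big_uniq //= (big_nth set0) size_s.
(* Natural subtraction is exact here: [3 <= k], and at most two joints. *)
rewrite (@eq_big_nat _ _ _ _ _ _ (fun i => k - 3 + (i == 0) + (i == n))); last first.
  move=> i /andP[_ lt_i]; rewrite card_private_nth ?size_s //.
  by case: i lt_i => [|i] lt_i; lia.
rewrite !big_split /= sum_nat_const_nat subn0 -addnA; congr (_ + _).
rewrite big_nat_recl // big1 // big_nat_recr //= eqxx big_nat big1 // => i.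
by case/andP=> _ lt_i; rewrite ltn_eqF.
Qed.

End Hyperpath.

Unset Implicit Arguments.

Theorem corollary3p2 (V : finType) (H : hypergraph V) (k m : nat)
  (Hconn : hconnected H) (Hsperner : sperner H)
  (k_ge4 : 4 <= k) (Hunif : uniform H k) (Hlin : linear_hypergraph H)
  (Hpath : hyperpath H)
  (m_gt0 : 0 < m) (Hm : #|hyperedges H| = m) :
  location_domination_number H = m * (k - 3) + 2.
Proof.
have [s [uniq_s memE meetP]] := Hpath.
have size_s : size s = m.
  by rewrite -Hm -(eq_card memE); apply/esym/card_uniqP.
rewrite location_domination_number_linear // => [|E]; last first.
  rewrite -memE => /(nthP set0)[i lt_i <-].
  rewrite (card_private_nth Hunif Hlin uniq_s memE meetP lt_i).
  by have := (leq_b1 (0 < i), leq_b1 (i.+1 < size s)); lia.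
by rewrite (sum_private_hyperpath Hunif Hlin uniq_s memE meetP) ?size_s //; lia.
Qed.
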